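(* Let $t\ge 1$ be an integer and let $G$ be a finite graph without an induced matching of size $t$. Then $h(G)\le 10\,t^t\,\omega(G)^{3t-3}\log\omega(G)$.
   Context: For a graph $G$, $\omega(G)$ denotes its clique number, and $h(G)$ denotes the smallest size of a subset of $V(G)$ that intersects every maximum independent set of $G$ (an independent set of size $\alpha(G)$, the independence number). An induced matching of size $t$ in $G$ consists of vertices $a_1,b_1,\dots,a_t,b_t$ such that the subgraph of $G$ induced on $\{a_i,b_i\}_{i\in[t]}$ has edge set exactly $\{a_ib_i : i\in[t]\}$. $\log$ denotes the natural logarithm.
   Formalization: The theorem assumes ω(G) ≥ 2; for ω(G) = 1 the graph is nonempty and edgeless, so h(G) = 1 while log ω(G) = 0 and the bound fails, and for the empty graph log ω(G) is undefined. *)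

(* Defs.v *)
From mathcomp Require Import all_boot.
Set Implicit Arguments. Unset Strict Implicit. Unset Printing Implicit Defensive.

(* A finite simple graph: vertex type T : finType, adjacency e : rel T,
   assumed symmetric and irreflexive (hypotheses in the theorem). *)
Section Graph.
Variables (T : finType) (e : rel T).

Definition is_clique (S : {set T}) : bool :=
  [forall x in S, forall y in S, (x != y) ==> e x y].

Definition is_stable (S : {set T}) : bool :=
  [forall x in S, forall y in S, ~~ e x y].

Definition clique_number : nat := \max_(S : {set T} | is_clique S) #|S|.

Definition indep_number : nat := \max_(S : {set T} | is_stable S) #|S|.

Definition max_stable (S : {set T}) : bool :=
  is_stable S && (#|S| == indep_number).

Definition hits_max_stable (X : {set T}) : bool :=
  [forall S : {set T}, max_stable S ==> (X :&: S != set0)].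

(* h(G): least size of a set meeting every maximum independent set
   (default #|T| only matters in the degenerate case T empty). *)
Definition h_number : nat :=
  \big[minn/#|T|]_(X : {set T} | hits_max_stable X) #|X|.

Definition has_induced_matching (t : nat) : Prop :=
  exists (a b : 'I_t -> T),
    injective (fun p : 'I_t * bool => if p.2 then a p.1 else b p.1) /\
    (forall i, e (a i) (b i)) /\
    (forall i j, i != j ->
       [/\ ~~ e (a i) (a j), ~~ e (a i) (b j), ~~ e (b i) (a j)
         & ~~ e (b i) (b j)]).

End Graph.

(* Main.v *)
From Stdlib Require Import ZArith Reals Lra.
Require Import Defs.
From mathcomp Require Import all_boot zify.
Set Implicit Arguments. Unset Strict Implicit. Unset Printing Implicit Defensive.

(** Let n be the number of vertices, w the clique number and t = s + 1. Wagon's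
    argument gives n <= w^(2s) alpha(G), so every maximum stable set contains a
    fraction at least w^(-2s) of the vertices. If these sets shatter X, then each
    x in X has a neighbour y_x whose only neighbour in X is x; having no induced
    matching of size t, the y_x contain no stable set of size t, so a Ramsey
    argument gives |X| <= s w^s. A hypergraph of large edges and small VC
    dimension has a small hitting set, by an epsilon-net argument: if no m
    vertices suffice, double sampling with the exponential moment
    2^(number of sample points in S) and Sauer-Shelah give
    (1 + w^(-2s))^m <= (2m + 1)^(s w^s), which bounds m. *)

(** * Shattering and the Sauer-Shelah bound *)

Definition shatters (T : finType) (F : {set {set T}}) (X : {set T}) : bool :=
  [forall Z : {set T}, (Z \subset X) ==> [exists S in F, S :&: X == Z]].

Lemma shattersP (T : finType) (F : {set {set T}}) (X : {set T}) :
  reflect (forall Z : {set T}, Z \subset X -> exists2 S, S \in F & S :&: X = Z)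
          (shatters F X).
Proof.
apply: (iffP forallP) => [h Z sZ | h Z].
  have /implyP /(_ sZ) /exists_inP [S SF /eqP E] := h Z.
  by exists S.
apply/implyP => sZ; apply/exists_inP.
by have [S SF E] := h Z sZ; exists S => //; apply/eqP.
Qed.

Lemma shatters_sub (T : finType) (F F' : {set {set T}}) (X : {set T}) :
  F \subset F' -> shatters F X -> shatters F' X.
Proof.
move=> /subsetP sF /shattersP h; apply/shattersP => Z sZ.
by have [S SF E] := h Z sZ; exists S => //; apply: sF.
Qed.

(* Pajor's strengthening of the Sauer-Shelah lemma. *)
Lemma leq_card_shattered (T : finType) (F : {set {set T}}) :
  #|F| <= #|[set X | shatters F X]|.
Proof.
have [k] := ubnP #|F|; elim: k F => // k IH F /ltnSE Fk.
have [F1 | F2] := leqP #|F| 1.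
  have [-> | [S SF]] := set_0Vmem F; first by rewrite cards0.
  apply: leq_trans F1 _; apply/card_gt0P; exists set0; rewrite inE.
  apply/shattersP => Z; rewrite subset0 => /eqP ->.
  by exists S => //; rewrite setI0.
have [A [B [AF BF AB]]] : exists A B, [/\ A \in F, B \in F & A != B].
  by have /card_gt1P [A [B [? ? ?]]] := F2; exists A, B.
(* A point separating two members of [F] splits [F] into two nonempty, hence strictly smaller,
   halves. *)
have [x] : exists x, (x \in A) != (x \in B).
  apply/existsP; apply: contraR AB => /existsPn h; apply/eqP/setP => x.
  by apply/eqP; have := h x; rewrite negbK.
move=> xAB.
pose F1 := [set S in F | x \in S]; pose F0 := [set S in F | x \notin S].
have FE : #|F| = #|F1| + #|F0|.
  rewrite -(cardsID [set S : {set T} | x \in S] F); congr (_ + _); apply: eq_card => S.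
    by rewrite !inE.
  by rewrite !inE andbC.
have [F1n F0n] : 0 < #|F1| /\ 0 < #|F0|.
  case xA : (x \in A) xAB; case xB : (x \in B) => //= _; split;
    apply/card_gt0P; by [exists A; rewrite inE ?AF ?xA | exists B; rewrite inE ?BF ?xB].
have IH1 : #|F1| <= #|[set X | shatters F1 X]|.
  by apply: IH; apply: leq_trans Fk; rewrite FE -addn1 leq_add2l.
have IH0 : #|F0| <= #|[set X | shatters F0 X]|.
  by apply: IH; apply: leq_trans Fk; rewrite FE -add1n leq_add2r.
pose s1 := [set X | shatters F1 X]; pose s0 := [set X | shatters F0 X].
have F1s : F1 \subset F by apply/subsetP => S; rewrite inE => /andP [].
have F0s : F0 \subset F by apply/subsetP => S; rewrite inE => /andP [].
have nx1 X : X \in s1 -> x \notin X.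
  rewrite inE => /shattersP /(_ set0 (sub0set _)) [S].
  rewrite inE => /andP [_ xS] E; apply/negP => xX.
  by have := in_set0 x; rewrite -E inE xS xX.
have nx0 X : X \in s0 -> x \notin X.
  rewrite inE => /shattersP /(_ X (subxx _)) [S].
  rewrite inE => /andP [_ xS] E; apply/negP => xX.
  by move: xX; rewrite -E inE (negbTE xS).
(* A set [X] shattered by both halves is counted twice, and the second count is charged to [x |: X],
   which [F] shatters too. The charged sets contain [x], while no member of [s1] or [s0] does. *)
rewrite FE (leq_trans (leq_add IH1 IH0)) // -/s1 -/s0 -cardsUI.
have inj : {in s1 :&: s0 &, injective (fun X => x |: X)}.
  move=> X Y; rewrite !in_setI => /andP [/nx1 xX _] /andP [/nx1 xY _] E.
  by rewrite -(setU1K xX) E (setU1K xY).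
rewrite -(card_in_imset inj) -cardsUI.
have -> : (s1 :|: s0) :&: [set x |: X | X in s1 :&: s0] = set0.
  apply/setP => X; rewrite in_set0; apply/negbTE/negP.
  rewrite in_setI => /andP [/setUP h /imsetP [Y _ E]].
  by have : x \notin X; [case: h => [/nx1|/nx0] | rewrite E setU11].
rewrite cards0 addn0; apply: subset_leq_card; apply/subsetP => X.
case/setUP => [/setUP [] | /imsetP [Y]].
- by rewrite !inE; apply: shatters_sub.
- by rewrite !inE; apply: shatters_sub.
rewrite in_setI => /andP [Y1 Y0] ->; rewrite inE.
have xY := nx1 Y Y1.
move: Y1 Y0; rewrite !inE => /shattersP h1 /shattersP h0.
apply/shattersP => Z sZ.
have sZY : Z :\ x \subset Y by rewrite subDset.
have [xZ | xZ] := boolP (x \in Z).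
  have [S] := h1 _ sZY; rewrite inE => /andP [SF xS] E; exists S => //.
  by rewrite setIUr E (setIidPr _) ?sub1set // setD1K.
have [S] := h0 _ sZY; rewrite inE => /andP [SF xS] E; exists S => //.
rewrite setIUr E; have -> : S :&: [set x] = set0.
  apply/eqP; rewrite setI_eq0 disjoint_sym disjoints1.
  exact: xS.
rewrite set0U; apply/setP => y; rewrite !inE.
by case: eqP => // ->; rewrite (negbTE xZ).
Qed.

(** A list of at most [d] elements of [Y], padded with [None], is a function from ['I_d] to an
    option type with [#|Y|.+1] values. *)
Lemma card_small_subsets (T : finType) (Y : {set T}) (d : nat) :
  #|[set X : {set T} | (X \subset Y) && (#|X| <= d)]| <= #|Y|.+1 ^ d.
Proof.
pose f (g : {ffun 'I_d -> option {x | x \in Y}}) : {set T} :=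
  [set x | [exists i, omap val (g i) == Some x]].
have -> : #|Y|.+1 ^ d = #|{ffun 'I_d -> option {x | x \in Y}}|.
  by rewrite card_ffun card_ord card_option card_sig.
rewrite -cardsT; apply: leq_trans (leq_imset_card f _).
apply: subset_leq_card; apply/subsetP => X; rewrite inE => /andP [sXY Xd].
apply/imsetP.
exists [ffun i : 'I_d => obind insub (onth (enum X) i)]; rewrite ?inE //.
apply/setP => x; rewrite inE; apply/idP/existsP => [xX | [i]].
  have ix : index x (enum X) < #|X| by rewrite cardE index_mem mem_enum.
  exists (Ordinal (leq_trans ix Xd)); rewrite ffunE /=.
  rewrite onthE (nth_map x) ?index_mem ?mem_enum // nth_index ?mem_enum //=.
  by rewrite insubT ?(subsetP sXY).
rewrite ffunE; case E : (onth _ _) => [y|] //=.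
case: insubP => //= u _ -> /eqP [<-].
have : y \in enum X by apply/onthP; exists i.
by rewrite mem_enum.
Qed.

(** * Hitting sets by double sampling *)

Section HittingSets.
Variables (T : finType) (F : {set {set T}}) (a d m : nat).
Hypothesis T_gt0 : 0 < #|T|.
Hypothesis F_large : forall S, S \in F -> a <= #|S|.
Hypothesis F_vc : forall X, shatters F X -> #|X| <= d.
Hypothesis F_unhit :
  forall X : {set T}, #|X| <= m -> exists2 S, S \in F & X :&: S = set0.

Let sample := {ffun 'I_m -> T}.

Definition support (z : sample * sample) : {set T} :=
  [set z.1 i | i in 'I_m] :|: [set z.2 i | i in 'I_m].

Definition traces (z : sample * sample) : {set {set T}} :=
  [set S :&: support z | S in F].

(** Multiplied over the coordinates, this is the indicator that the first sample misses [A], times 2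
    to the number of hits of the second. *)
Definition weight (A : {set T}) (u v : T) : nat :=
  (u \notin A) * 2 ^ (v \in A).

(** Symmetrization: exchanging coordinates permutes the double samples and leaves [traces]
    unchanged, so a sum over double samples may be averaged over [s]. *)
Definition swap (s : {ffun 'I_m -> bool}) (z : sample * sample) :
    sample * sample :=
  ([ffun i => if s i then z.2 i else z.1 i],
   [ffun i => if s i then z.1 i else z.2 i]).

Lemma swapK s : involutive (swap s).
Proof.
by case=> u v; congr pair; apply/ffunP => i; rewrite !ffunE /= ?ffunE; case: (s i).
Qed.

Lemma support_swap s z : support (swap s z) = support z.
Proof.
apply/setP => x; rewrite !inE; apply/orP/orP.
  by case=> /imsetP [i _ ->]; rewrite /= ffunE; case: (s i);
    [right|left|left|right]; apply: imset_f.
case=> /imsetP [i _ ->]; case si: (s i).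
- by right; apply/imsetP; exists i; rewrite //= ffunE si.
- by left; apply/imsetP; exists i; rewrite //= ffunE si.
- by left; apply/imsetP; exists i; rewrite //= ffunE si.
- by right; apply/imsetP; exists i; rewrite //= ffunE si.
Qed.

(** A set shattered by the traces lies in the support, which has at most [2 * m] points, and is
    shattered by [F], so it has at most [d] elements. Pajor's bound reduces the count to such
    sets. *)
Lemma card_traces z : #|traces z| <= (2 * m).+1 ^ d.
Proof.
have sub : [set X | shatters (traces z) X]
    \subset [set X : {set T} | (X \subset support z) && (#|X| <= d)].
  apply/subsetP => X; rewrite !inE => /shattersP h.
  have sX : X \subset support z.
    have [S /imsetP [S' _ ->] <-] := h X (subxx _).
    by rewrite -setIA setIC -setIA subsetIl.
  rewrite sX F_vc //; apply/shattersP => Z sZ.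
  have [_ /imsetP [S SF ->] E] := h Z sZ; exists S => //.
  by rewrite -E -setIA (setIidPr sX).
apply: leq_trans (leq_card_shattered _) _.
apply: leq_trans (subset_leq_card sub) _.
apply: leq_trans (card_small_subsets _ _) _.
have [-> | d_gt0] := posnP d; first by rewrite !expn0.
rewrite leq_exp2r // ltnS.
have im (f : sample) : #|[set f i | i in 'I_m]| <= m.
  by rewrite -[X in _ <= X]card_ord leq_imset_card.
by rewrite (leq_trans (leq_card_setU _ _)) // mul2n -addnn leq_add.
Qed.

(* The exponential weight makes every coordinate contribute at most 2 after
   symmetrization, so that the total is bounded by the number of traces. *)
Lemma sum_weight_swap A (z : sample * sample) :
  \sum_(s : {ffun 'I_m -> bool})
    \prod_(i < m) weight A ((swap s z).1 i) ((swap s z).2 i) <= 2 ^ m.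
Proof.
have -> : \sum_(s : {ffun 'I_m -> bool})
    \prod_(i < m) weight A ((swap s z).1 i) ((swap s z).2 i) =
  \prod_(i < m) \sum_(b : bool)
    weight A (if b then z.2 i else z.1 i) (if b then z.1 i else z.2 i).
  by rewrite bigA_distr_bigA; apply: eq_bigr => s _; apply: eq_bigr => i _;
    rewrite !ffunE.
rewrite -[m in X in _ <= X]card_ord -prod_nat_const; apply: leq_prod => i _.
rewrite big_bool /weight.
by case: (_ \in A); case: (_ \in A).
Qed.

Lemma sum_pow2 (A : {set T}) :
  \sum_(M : sample) \prod_(i < m) 2 ^ (M i \in A) = (#|T| + #|A|) ^ m.
Proof.
rewrite -(bigA_distr_bigA (fun (_ : 'I_m) x => 2 ^ (x \in A))).
rewrite prod_nat_const card_ord; congr (_ ^ _).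
transitivity (\sum_x (1 + (x \in A))).
  by apply: eq_bigr => x _; case: (x \in A).
rewrite big_split /= sum1_card; congr (_ + _).
by rewrite -sum1_card [RHS]big_mkcond; apply: eq_bigr => x _; case: (x \in A).
Qed.

(* Each m-sample N misses some S in F, and a second sample M then satisfies
   E 2^#{i | M i \in S} >= (1 + a/n)^m. *)
Lemma unhit_family_bound :
  (#|T| + a) ^ m <= #|T| ^ m * (2 * m).+1 ^ d.
Proof.
have /fin_all_exists [f fP] : forall N : sample, exists S : {set T},
    S \in F /\ forall i, N i \notin S.
  move=> N; have [|S SF E] := F_unhit (X := [set N i | i in 'I_m]).
    by rewrite -[X in _ <= X]card_ord leq_imset_card.
  exists S; split=> // i; apply/negP => NS.
  by have := in_set0 (N i); rewrite -E inE NS imset_f.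
pose G (z : sample * sample) :=
  \sum_(A in traces z) \prod_(i < m) weight A (z.1 i) (z.2 i).
(* Of all traces only that of [f N] is kept: [N] misses it, so its weights sum over [M] to the full
   exponential moment. *)
have low : #|T| ^ m * (#|T| + a) ^ m <= \sum_z G z.
  rewrite -(pair_bigA _ (fun N M => G (N, M))) /=.
  rewrite -[m in X in X * _]card_ord -card_ffun -sum_nat_const.
  apply: leq_sum => N _; have [fF fN] := fP N.
  apply: (@leq_trans ((#|T| + #|f N|) ^ m)).
    have [->|m_gt0] := posnP m; first by rewrite !expn0.
    by rewrite leq_exp2r // leq_add2l F_large.
  rewrite -sum_pow2; apply: leq_sum => M _.
  have fT : f N :&: support (N, M) \in traces (N, M) by apply: imset_f.
  rewrite /G (bigD1 _ fT) /=.
  apply: leq_trans (leq_addr _ _).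
  apply: leq_prod => i _; rewrite /weight !inE (negbTE (fN i)) mul1n.
  by rewrite (imset_f M) // orbT andbT.
(* Averaging over all [2 ^ m] swaps turns the weight of each trace into at most 1 on average,
   leaving the number of traces. *)
have up : 2 ^ m * \sum_z G z <= 2 ^ m * (#|T| ^ m * #|T| ^ m * (2 * m).+1 ^ d).
  have -> : 2 ^ m * \sum_z G z =
      \sum_(s : {ffun 'I_m -> bool}) \sum_z G (swap s z).
    transitivity (\sum_(s : {ffun 'I_m -> bool}) \sum_z G z).
      by rewrite sum_nat_const card_ffun card_bool card_ord.
    by apply: eq_bigr => s _; rewrite [LHS](reindex_inj (inv_inj (swapK s))).
  rewrite exchange_big /=.
  apply: (@leq_trans (\sum_(z : sample * sample) 2 ^ m * (2 * m).+1 ^ d)).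
    apply: leq_sum => z _.
    have -> : \sum_s G (swap s z) = \sum_(A in traces z)
        \sum_s \prod_(i < m) weight A ((swap s z).1 i) ((swap s z).2 i).
      rewrite exchange_big /=; apply: eq_bigr => s _.
      by rewrite /G /traces support_swap.
    apply: leq_trans (leq_sum _ (fun A _ => sum_weight_swap A z)) _.
    by rewrite sum_nat_const mulnC leq_mul2l card_traces orbT.
  rewrite sum_nat_const card_prod !card_ffun !card_ord.
  by rewrite mulnCA leqnn.
have Tm_gt0 : 0 < #|T| ^ m by rewrite expn_gt0 T_gt0.
rewrite -(leq_pmul2l Tm_gt0) mulnA (leq_trans low) //.
by rewrite -(leq_pmul2l (expn_gt0 2 m)).
Qed.

End HittingSets.

(** * Elementary facts on cliques, stable sets and [h_number] *)

Lemma is_cliqueP (T : finType) (e : rel T) (S : {set T}) :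
  reflect {in S &, forall x y, x != y -> e x y} (is_clique e S).
Proof.
apply: (iffP forall_inP) => [h x y xS yS | h x xS].
  by apply/implyP; exact: (forall_inP (h x xS)).
by apply/forall_inP => y yS; apply/implyP; exact: h.
Qed.

Lemma is_stableP (T : finType) (e : rel T) (S : {set T}) :
  reflect {in S &, forall x y, ~~ e x y} (is_stable e S).
Proof.
apply: (iffP forall_inP) => [h x y xS yS | h x xS].
  exact: (forall_inP (h x xS)).
by apply/forall_inP => y yS; exact: h.
Qed.

Lemma card_clique_leq (T : finType) (e : rel T) (S : {set T}) :
  is_clique e S -> #|S| <= clique_number e.
Proof. exact: leq_bigmax_cond. Qed.

Lemma card_stable_leq (T : finType) (e : rel T) (S : {set T}) :
  is_stable e S -> #|S| <= indep_number e.
Proof. exact: leq_bigmax_cond. Qed.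

Lemma is_clique0 (T : finType) (e : rel T) : is_clique e set0.
Proof. by apply/is_cliqueP => x y; rewrite inE. Qed.

Lemma h_number_leq (T : finType) (e : rel T) (X : {set T}) :
  hits_max_stable e X -> h_number e <= #|X|.
Proof.
rewrite /h_number => hX; have := mem_index_enum X.
elim: (index_enum _) => // Y s IH; rewrite in_cons big_cons => /orP [/eqP <-|/IH h].
  by rewrite hX geq_minl.
by case: ifP => // _; apply: leq_trans (geq_minr _ _) h.
Qed.

Lemma max_clique_in (T : finType) (e : rel T) (W : {set T}) :
  exists K : {set T}, [/\ K \subset W, is_clique e K &
    forall K' : {set T}, K' \subset W -> is_clique e K' -> #|K'| <= #|K|].
Proof.
have h0 : (set0 \subset W) && is_clique e set0 by rewrite sub0set is_clique0.
case: (@arg_maxnP _ set0 (fun K : {set T} => (K \subset W) && is_clique e K)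
  (fun K => #|K|) h0) => K /andP [KW Kc] Kmax.
by exists K; split=> // K' K'W K'c; apply: Kmax; rewrite K'W K'c.
Qed.

Lemma card_leq_cover (I T : finType) (K : {set I}) (B : I -> {set T})
    (W : {set T}) c :
  (forall v, v \in W -> exists2 k, k \in K & v \in B k) ->
  (forall k, k \in K -> #|B k| <= c) -> #|W| <= #|K| * c.
Proof.
move=> cover bound; apply: (@leq_trans #|\bigcup_(k in K) B k|).
  apply/subset_leq_card/subsetP => v /cover [k kK vk].
  by apply/bigcupP; exists k.
rewrite -sum_nat_const; elim/big_rec2: _ => [|k n U kK Un].
  by rewrite cards0.
by rewrite (leq_trans (leq_card_setU _ _)) // leq_add // bound.
Qed.

(** * Graphs without a large induced matching *)

Section Graph.
Variables (T : finType) (e : rel T).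
Hypotheses (e_sym : symmetric e) (e_irr : irreflexive e).

Lemma is_cliqueU1 (K : {set T}) v :
  is_clique e K -> {in K, forall k, e v k} -> is_clique e (v |: K).
Proof.
move=> /is_cliqueP Kc vK; apply/is_cliqueP => x y.
rewrite !inE => /predU1P [->|xK] /predU1P [->|yK] xy.
- by rewrite eqxx in xy.
- exact: vK.
- by rewrite e_sym vK.
- exact: Kc.
Qed.

Lemma max_clique_nonneighbor (W K : {set T}) v :
  K \subset W -> is_clique e K ->
  (forall K' : {set T}, K' \subset W -> is_clique e K' -> #|K'| <= #|K|) ->
  v \in W -> exists2 k, k \in K & ~~ e v k.
Proof.
move=> KW Kc Kmax vW; apply/exists_inP; apply: contraT => /exists_inPn h.
have vK k : k \in K -> e v k by move=> /h; rewrite negbK.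
have vnK : v \notin K by apply/negP => /vK; rewrite e_irr.
have := Kmax (v |: K); rewrite subUset sub1set vW KW is_cliqueU1 //.
by rewrite cardsU1 vnK add1n ltnn => /(_ isT isT).
Qed.

(** Ramsey argument: the nonneighbourhoods of the vertices of a maximum clique of [Y] cover [Y]. A
    largest one is recursed into, and its clique vertex joins the stable set found there. *)
Lemma stable_subset_exists s (Y : {set T}) :
  s * clique_number e ^ s < #|Y| ->
  exists Z : {set T}, [/\ Z \subset Y, is_stable e Z & #|Z| = s.+1].
Proof.
elim: s Y => [|s IH] Y.
  rewrite mul0n => /card_gt0P [y yY]; exists [set y]; rewrite sub1set yY cards1.
  by split=> //; apply/is_stableP => u v; rewrite !inE => /eqP -> /eqP ->; rewrite e_irr.
move=> Ylarge; set w := clique_number e in IH Ylarge.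
have [K [KY Kc Kmax]] := max_clique_in e Y.
have [k kK klarge] : exists2 k, k \in K &
    s.+1 * w ^ s < #|[set v in Y | ~~ e v k]|.
  apply/exists_inP; apply: contraLR Ylarge => /exists_inPn h.
  rewrite -leqNgt expnS mulnCA.
  apply: (@leq_trans (#|K| * (s.+1 * w ^ s))); last first.
    by rewrite leq_mul2r card_clique_leq ?orbT.
  apply: (card_leq_cover (B := fun k => [set v in Y | ~~ e v k])) => [v vY|k /h].
    have [k kK vk] := max_clique_nonneighbor KY Kc Kmax vY.
    by exists k => //; rewrite inE vY.
  by rewrite -leqNgt.
have kY : k \in Y := subsetP KY _ kK.
have w_gt0 : 0 < w.
  by apply: leq_trans (card_clique_leq Kc); apply/card_gt0P; exists k.
(* The vertex [k] is its own nonneighbour and must be removed; passing from [s.+1 * w ^ s] to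
   [s * w ^ s] pays for it since [w ^ s] is positive. *)
have [|Z [ZY Zst Zc]] := IH ([set v in Y | ~~ e v k] :\ k).
  move: klarge; rewrite (cardsD1 k) inE kY e_irr /= add1n ltnS.
  by apply: leq_trans; rewrite mulSn -add1n leq_add2r expn_gt0 w_gt0.
have nk v : v \in Z -> [/\ v != k, v \in Y & ~~ e v k].
  by move=> /(subsetP ZY); rewrite !inE => /and3P [].
exists (k |: Z); split.
- by apply/subsetP => v /setU1P [-> //|/nk []].
- apply/is_stableP => x y /setU1P [->|xZ] /setU1P [->|yZ].
  + by rewrite e_irr.
  + by rewrite e_sym; case: (nk _ yZ).
  + by case: (nk _ xZ).
  + exact: (is_stableP _ _ Zst).
- by rewrite cardsU1 Zc; case: (boolP (k \in Z)) => // /nk []; rewrite eqxx.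
Qed.

(** The version relative to [W] serves the induction on the size of the matching, which passes to
    subsets. *)
Definition matching_in (W : {set T}) (t : nat) (a b : 'I_t -> T) : Prop :=
  (forall i, [/\ a i \in W, b i \in W & e (a i) (b i)]) /\
  (forall i j, i != j -> [/\ ~~ e (a i) (a j), ~~ e (a i) (b j),
                            ~~ e (b i) (a j) & ~~ e (b i) (b j)]).

(** Injectivity comes from the edges: a coincidence of endpoints would give a loop or an edge
    between two different pairs. *)
Lemma matching_in_has W t (a b : 'I_t -> T) :
  matching_in W a b -> has_induced_matching e t.
Proof.
move=> [ed nd]; exists a, b; split; last by split=> // i; case: (ed i).
have ab i : e (a i) (b i) by case: (ed i).
have aa i j : a i = a j -> i = j.
  move=> E; apply/eqP; apply: contraT => /nd [_ + _ _].
  by rewrite E ab.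
have bb i j : b i = b j -> i = j.
  move=> E; apply/eqP; apply: contraT => /nd [_ + _ _].
  by rewrite -E ab.
have abF i j : a i <> b j.
  move=> E; have [ij|/nd [+ _ _ _]] := eqVneq i j.
    by have := ab i; rewrite E ij e_irr.
  by rewrite E e_sym ab.
by case=> [i []] [j []] //= E; rewrite ?(aa _ _ E) ?(bb _ _ E) //;
  [case: (abF _ _ E) | case: (abF _ _ (esym E))].
Qed.

Lemma matching_in_cons (W : {set T}) t (a b : 'I_t -> T) u v :
  u \in W -> v \in W -> e u v ->
  matching_in [set x in W | ~~ e x u && ~~ e x v] a b ->
  exists a' b' : 'I_t.+1 -> T, matching_in W a' b'.
Proof.
move=> uW vW uv [ed nd].
exists (fun i => oapp a u (unlift ord0 i)), (fun i => oapp b v (unlift ord0 i)).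
have {}ed i : [/\ a i \in W, b i \in W, e (a i) (b i) &
    [/\ ~~ e (a i) u, ~~ e (a i) v, ~~ e (b i) u & ~~ e (b i) v]].
  by have [] := ed i; rewrite !inE => /and3P [? ? ?] /and3P [? ? ?] ?.
split=> [i | i j].
  by case: unliftP => [k _|_] //=; case: (ed k).
case: unliftP => [k ->|->]; case: unliftP => [l ->|->] //= ij.
- by apply: nd; apply: contraNneq ij => ->.
- by case: (ed k) => _ _ _ [].
- by case: (ed l) => _ _ _ []; rewrite !(e_sym u) !(e_sym v).
Qed.

(* Wagon's argument: relative to a maximum clique K, a vertex either misses
   two vertices of K (and those missing a given pair k, k' contain no induced
   matching of size one less, because of the edge kk'), or misses exactly one
   (and those missing exactly k form a stable set). *)
Lemma card_leq_no_matching s (W : {set T}) :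
  (forall a b : 'I_s.+1 -> T, ~ matching_in W a b) ->
  #|W| <= (clique_number e ^ 2) ^ s * indep_number e.
Proof.
elim: s W => [|s IH] W noM.
  rewrite expn0 mul1n; apply: card_stable_leq; apply/is_stableP => x y xW yW.
  apply/negP => xy; apply: (noM (fun=> x) (fun=> y)); split=> // i j.
  by rewrite !ord1 eqxx.
have [K [KW Kc Kmax]] := max_clique_in e W.
set w := clique_number e in IH *; set c := (w ^ 2) ^ s * indep_number e in IH.
(* A diagonal pair [(k, k)] collects the vertices whose only nonneighbour in [K] is [k]. *)
pose B (p : T * T) := [set v in W | ~~ e v p.1 && ~~ e v p.2 &
    (p.1 == p.2) ==> [forall k in K, (k != p.1) ==> e v k]].
apply: (@leq_trans (#|setX K K| * c)); last first.
  rewrite cardsX /c (expnS (w ^ 2)) -(mulnA (w ^ 2)) leq_mul2r; apply/orP; right.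
  by rewrite -mulnn leq_mul // card_clique_leq.
apply: (card_leq_cover (B := B)) => [v vW | [k k'] /setXP [/= kK k'K]].
  have [k kK vk] := max_clique_nonneighbor KW Kc Kmax vW.
  have [h|] := boolP [forall k' in K, (k' != k) ==> e v k'].
    by exists (k, k); rewrite ?inE /= ?kK // vW vk h implybT.
  case/forall_inPn => k' k'K; rewrite negb_imply => /andP [k'k vk'].
  by exists (k, k'); rewrite ?inE /= ?kK ?k'K // vW vk vk' eq_sym (negbTE k'k).
have [<-{k' k'K} | kk'] := eqVneq k k'.
  apply: (@leq_trans (indep_number e)).
    apply: card_stable_leq; apply/is_stableP => x y; rewrite !inE /= eqxx /=.
    rewrite !andbb => /and3P [xW xk /forall_inP xK] /and3P [yW yk /forall_inP yK].
    (* Replacing [k] in [K] by the adjacent vertices [x] and [y] would give a larger clique inside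
       [W]. *)
    apply/negP => xy.
    have K1c : is_clique e (K :\ k).
      apply/is_cliqueP => p q; rewrite !inE => /andP [_ pK] /andP [_ qK].
      exact: (is_cliqueP _ _ Kc).
    have K2c : is_clique e (y |: K :\ k).
      by apply: is_cliqueU1 => // q /setD1P [qk /yK]; rewrite qk.
    have xy_ne : x != y by apply: contraTneq xy => ->; rewrite e_irr.
    have nK q : ~~ e q k -> q \notin K :\ k.
      apply: contra => /setD1P [qk qK]; exact: (is_cliqueP _ _ Kc).
    have xN : x \notin y |: K :\ k by rewrite in_setU1 negb_or xy_ne nK.
    have K3c : is_clique e (x |: (y |: K :\ k)).
      apply: is_cliqueU1 => // q /setU1P [-> //|/setD1P [qk /xK]].
      by rewrite qk.
    have /Kmax /(_ K3c) : x |: (y |: K :\ k) \subset W.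
      by rewrite !subUset !sub1set xW yW (subset_trans (subsetDl _ _) KW).
    by rewrite !cardsU1 xN nK // (cardsD1 k K) kK ltnn.
  rewrite /c -[X in X <= _]mul1n leq_mul2r; apply/orP; right.
  rewrite expn_gt0 expn_gt0 (leq_trans _ (card_clique_leq Kc)) //.
  by apply/card_gt0P; exists k.
apply: IH => a b M.
have [||||a' [b' M']] := @matching_in_cons W _ a b k k'.
- exact: (subsetP KW).
- exact: (subsetP KW).
- exact: (is_cliqueP _ _ Kc).
- case: M => ed nd; split=> // i; have [] := ed i; rewrite !inE /= (negbTE kk').
  by rewrite !andbT.
- exact: noM M'.
Qed.

Lemma max_stable_neighbor (S : {set T}) x :
  max_stable e S -> x \notin S -> exists2 y, y \in S & e x y.
Proof.
move=> /andP [/is_stableP Sst /eqP Sc] xS; apply/exists_inP.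
apply: contraT => /exists_inPn h.
have : is_stable e (x |: S).
  apply/is_stableP => u v /setU1P [->|uS] /setU1P [->|vS].
  - by rewrite e_irr.
  - exact: h.
  - by rewrite e_sym; exact: h.
  - exact: Sst.
by move=> /card_stable_leq; rewrite cardsU1 xS Sc add1n ltnn.
Qed.

(* For x in a shattered set X, a maximum stable set meeting X exactly in
   X minus x contains a neighbour y of x, and y has no other neighbour in X. A
   stable set of such y's thus yields an induced matching. *)
Lemma card_shattered_max_stable s (X : {set T}) :
  ~ has_induced_matching e s.+1 ->
  shatters [set S | max_stable e S] X -> #|X| <= s * clique_number e ^ s.
Proof.
move=> noM /shattersP sh; rewrite leqNgt; apply/negP => Xlarge.
have [S0] := sh X (subxx _); rewrite inE => /andP [/is_stableP S0st _] S0X.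
(* The trace equal to [X] itself places [X] inside a stable set. *)
have Xst : {in X &, forall x y, ~~ e x y}.
  by move=> x y; rewrite -S0X => /setIP [xS _] /setIP [yS _]; exact: S0st.
have /fin_all_exists [f fP] : forall x, exists y, x \in X ->
    e x y /\ {in X, forall z, z != x -> ~~ e y z}.
  move=> x; have [xX|] := boolP (x \in X); last by exists x.
  have [S] := sh (X :\ x) (subsetDl _ _); rewrite inE => Smax SX.
  have [|y yS xy] := @max_stable_neighbor S x Smax.
    by apply/negP => xS; have := setD11 x X; rewrite -SX inE xS xX.
  exists y => _; split=> // z zX zx; have /setIP [zS _] : z \in S :&: X.
    by rewrite SX !inE zx.
  by case/andP: Smax => /is_stableP + _; apply.
have f_inj : {in X &, injective f}.
  move=> x y xX yX fxy; apply/eqP; apply: contraT => xy.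
  have [_ /(_ _ xX xy)] := fP y yX.
  by rewrite -fxy e_sym; have [-> _] := fP x xX.
have [|Z [ZX Zst Zc]] := @stable_subset_exists s (f @: X).
  by rewrite card_in_imset.
pose A := [set x in X | f x \in Z].
have Ac : #|A| = s.+1.
  rewrite -Zc -(card_in_imset (f := f) (D := A)).
    apply: eq_card => y; apply/imsetP/idP => [[x + ->]|yZ].
      by rewrite inE => /andP [].
    have /imsetP [x xX E] := subsetP ZX _ yZ.
    by exists x; rewrite // inE xX -E.
  by move=> x y; rewrite !inE => /andP [xX _] /andP [yX _]; exact: f_inj.
pose a (i : 'I_s.+1) := enum_val (cast_ord (esym Ac) i).
have aA i : a i \in X /\ f (a i) \in Z.
  by have := enum_valP (cast_ord (esym Ac) i); rewrite inE => /andP.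
apply: noM; apply: (@matching_in_has setT _ a (f \o a)); split=> [i|i j ij].
  by split; rewrite ?inE //; have [aX _] := aA i; have [] := fP _ aX.
have [[iX iZ] [jX jZ]] := (aA i, aA j).
have aij : a i != a j.
  by apply: contraNneq ij => /enum_val_inj /cast_ord_inj ->.
have [_ hi] := fP _ iX; have [_ hj] := fP _ jX.
split; first exact: Xst.
- by rewrite e_sym; apply: hj.
- by apply: hi => //; rewrite eq_sym.
- exact: (is_stableP _ _ Zst).
Qed.

(** The sampling bound is applied to the maximum stable sets, all of size [indep_number e]. Wagon's
    bound, [#|T|] at most [q] times that size, then replaces the growth ratio by [q.+1 / q]. *)
Lemma unhit_max_stable_bound s m :
  0 < #|T| -> ~ has_induced_matching e s.+1 -> m < h_number e ->
  ((clique_number e ^ 2) ^ s).+1 ^ m <=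
    ((clique_number e ^ 2) ^ s) ^ m * (2 * m).+1 ^ (s * clique_number e ^ s).
Proof.
move=> T_gt0 noM mh; set q := (clique_number e ^ 2) ^ s.
pose F := [set S | max_stable e S].
have : (#|T| + indep_number e) ^ m <=
    #|T| ^ m * (2 * m).+1 ^ (s * clique_number e ^ s).
  apply: (@unhit_family_bound _ F) => // [S|X|X Xm].
  - by rewrite inE => /andP [_ /eqP ->].
  - exact: card_shattered_max_stable.
  have : ~~ hits_max_stable e X.
    by apply: contraL mh => /h_number_leq h; rewrite -leqNgt (leq_trans h).
  case/forallPn => S; rewrite negb_imply negbK => /andP [Smax /eqP E].
  by exists S; rewrite ?inE.
have Tq : #|T| <= q * indep_number e.
  rewrite -cardsT; apply: card_leq_no_matching => a b /matching_in_has.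
  exact: noM.
have [-> //|m_gt0] := posnP m.
have Tm_gt0 : 0 < #|T| ^ m by rewrite expn_gt0 T_gt0.
move=> h; rewrite -(leq_pmul2l Tm_gt0) mulnCA.
apply: leq_trans (leq_mul (leqnn (q ^ m)) h).
by rewrite -!expnMn leq_exp2r // mulnDr mulnS addnC mulnC leq_add2l.
Qed.

End Graph.

(** * Real estimates *)

Local Open Scope R_scope.

Lemma INR_expn m n : INR (expn m n) = pow (INR m) n.
Proof. by elim: n => [//|n IH]; rewrite expnS mult_INR IH. Qed.

Lemma leq_INR m n : (m <= n)%N -> INR m <= INR n.
Proof. by move=> /leP /le_INR. Qed.

Lemma ln_le_sub1 x : 0 < x -> ln x <= x - 1.
Proof.
move=> x0; rewrite -{2}(exp_ln x x0); have := exp_ineq1_le (ln x); lra.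
Qed.

Lemma ln_le x y : 0 < x -> x <= y -> ln x <= ln y.
Proof. by move=> x0 [xy|->]; [left; exact: ln_increasing | right]. Qed.

(** After taking logarithms, ln (q + 1) - ln q is at least 1 / (q + 1), hence at least 1 / (2 q). *)
Lemma exponent_leq_ln (q m d k : nat) :
  (q.+1 ^ m <= q ^ m * k.+1 ^ d)%N -> (0 < q)%N ->
  INR m <= 2 * INR q * (INR d * ln (INR k.+1)).
Proof.
move=> h q1.
have q1' : 1 <= INR q by apply: (leq_INR q1).
have k0 : 0 < INR (S k) by apply: lt_0_INR; lia.
have := leq_INR h; rewrite mult_INR !INR_expn => {}h.
have {}h := ln_le (pow_lt _ m (lt_0_INR _ (Nat.lt_0_succ q))) h.
rewrite ln_mult ?ln_pow in h; try apply: pow_lt; try lra; last first.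
  by apply: lt_0_INR; lia.
have : / (2 * INR q) <= ln (INR (S q)) - ln (INR q).
  have qs : INR (S q) = INR q + 1 by rewrite S_INR.
  have := @ln_le_sub1 (INR q / INR (S q)).
  have Sq_inv : 0 < / INR (S q) by apply: Rinv_0_lt_compat; lra.
  rewrite {1}/Rdiv ln_mult ?ln_Rinv; try lra.
  have -> : INR q / INR (S q) - 1 = - / (INR q + 1) by rewrite qs; field; lra.
  have : / (2 * INR q) <= / (INR q + 1) by apply: Rinv_le_contravar; lra.
  have : 0 < INR q / INR (S q) by apply: Rdiv_lt_0_compat; lra.
  lra.
move=> gap.
have : INR m * / (2 * INR q) <= INR d * ln (INR k.+1).
  apply: Rle_trans (Rmult_le_compat_l _ _ _ (pos_INR m) gap) _; lra.
move=> /(Rmult_le_compat_l (2 * INR q)) H.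
have {H}:= H ltac:(lra).
have -> : 2 * INR q * (INR m * / (2 * INR q)) = INR m by field; lra.
by [].
Qed.

(** With t = s + 1, this absorbs the polynomial factor of the final estimate into 8 t^t. For t at
    least 3 it follows from t^t being at least t^3. *)
Lemma poly_lt_selfexp s :
  (2 * s * (6 + s.+1 * s + 3 * s) < 8 * s.+1 ^ s.+1)%N.
Proof.
case: s => [|[|s]] //.
have : leq (S (S (S s)) ^ 3)%N (S (S (S s)) ^ S (S (S s)))%N by rewrite leq_exp2l.
rewrite !expnS expn0; nia.
Qed.

Lemma leq_from_exponent_bounds (s w h : nat) : (2 <= w)%N ->
  (forall k, (k < h)%N ->
   (((w ^ 2) ^ s).+1 ^ k <= ((w ^ 2) ^ s) ^ k * (2 * k).+1 ^ (s * w ^ s))%N) ->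
  INR h <= 10 * pow (INR s.+1) s.+1 * pow (INR w) (3 * s)%N * ln (INR w).
Proof.
move=> w2 H; set L := ln (INR w); set P := pow (INR (S s)) (S s).
set W := pow (INR w) (3 * s)%N; set Rr := _ * L.
have w2' : 2 <= INR w by have := leq_INR w2.
have L12 : ln 2 <= L by apply: ln_le; lra.
have L2 : / 2 < ln 2 by exact: ln_lt_2.
have LwI : L <= INR w - 1 by apply: ln_le_sub1; lra.
have S1 : 1 <= INR (S s) by rewrite S_INR; have := pos_INR s; lra.
have P1 : 1 <= P by apply: pow_R1_Rle.
have W1 : 1 <= W by apply: pow_R1_Rle; lra.
have PW1 : 1 <= P * W by nra.
have PWL : / 2 <= P * W * L by nra.
have RE : Rr = 10 * (P * W * L) by rewrite /Rr; ring.
apply: Rnot_lt_le => hR.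
(* The sample size is the integer part of the claimed bound; if the bound fails, it is below [h]. *)
have [m [mR Rm]] : exists m, INR m <= Rr < INR m + 1.
  exists (Z.to_nat (Int_part Rr)).
  have [b1 b2] := base_Int_part Rr.
  have ip : (0 <= Int_part Rr)%Z.
    have : (-1 < Int_part Rr)%Z by apply: lt_IZR; lra.
    lia.
  rewrite INR_IZR_INZ Z2Nat.id //; lra.
have mh : leq (S m) h by apply/leP/INR_lt; lra.
have q1 : leq 1 ((w ^ 2) ^ s)%N by rewrite !expn_gt0; lia.
have := exponent_leq_ln (H m mh) q1.
(* From 2m + 1 at most 32 P W w: ln 32 and ln w contribute 5 L + L, ln P at most (s + 1) s L because
   s + 1 is at most 2^s, and ln W exactly 3 s L. *)
have lnb : ln (INR (S (2 * m)%N)) <= L * (6 + INR (S s) * INR s + 3 * INR s).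
  have w0 : 0 < INR w by lra.
  have e1 : INR (S (2 * m)%N) <= 32 * P * W * INR w.
    rewrite S_INR mult_INR [INR 2]/=.
    have : P * W * L <= P * W * INR w by apply: Rmult_le_compat_l; lra.
    lra.
  apply: Rle_trans (ln_le _ e1) _; first by apply: lt_0_INR; lia.
  have e2 : ln (INR (S s)) <= INR s * L.
    apply: (@Rle_trans _ (INR s * ln 2)); last first.
      by apply: Rmult_le_compat_l; [exact: pos_INR | lra].
    rewrite -ln_pow; last lra.
    apply: ln_le; first lra.
    have -> : 2 = INR 2 by [].
    by rewrite -INR_expn; apply: leq_INR; exact: ltn_expl.
  have P0 : 0 < P by lra.
  have W0 : 0 < W by lra.
  rewrite (ln_mult (32 * P * W)) ?(ln_mult (32 * P)) ?(ln_mult 32); try nra.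
  have -> : ln 32 = 5 * ln 2.
    have -> : 32 = pow 2 5 by ring.
    rewrite ln_pow; last lra.
    congr (_ * _); rewrite /=; lra.
  rewrite {1}/P {1}/W !ln_pow; try lra.
  rewrite -/L [INR (3 * s)%N]mult_INR [INR 3]/=.
  have := Rmult_le_compat_l _ _ _ (pos_INR (S s)) e2.
  lra.
have WE : INR (((w ^ 2) ^ s)%N) * INR (w ^ s)%N = W.
  by rewrite !INR_expn -!pow_mult -pow_add /W; f_equal; lia.
set B := _ + _ in lnb.
have PB : 2 * INR s * B + 1 <= 8 * P.
  have := leq_INR (poly_lt_selfexp s).
  rewrite S_INR !mult_INR !plus_INR !mult_INR INR_expn -/P /B !S_INR /=; lra.
rewrite mult_INR => mle.
have WL0 : 0 < W * L by apply: Rmult_lt_0_compat; lra.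
have h1 : INR m <= 2 * W * (INR s * (L * B)).
  apply: Rle_trans mle _.
  rewrite -WE; set Q := INR ((w ^ 2) ^ s)%N; set V := INR (w ^ s)%N.
  have -> : 2 * Q * (INR s * V * ln (INR (S (2 * m)%N))) =
      2 * (Q * V) * INR s * ln (INR (S (2 * m)%N)) by ring.
  have -> : 2 * (Q * V) * (INR s * (L * B)) = 2 * (Q * V) * INR s * (L * B) by ring.
  apply: Rmult_le_compat_l => //; rewrite WE.
  by apply: Rmult_le_pos; [lra | exact: pos_INR].
(* Hence m is below 8 P W L, whereas m exceeds 10 P W L - 1; this contradicts P W L being at least
   1/2. *)
have : W * L * (2 * INR s * B + 1) <= W * L * (8 * P).
  by apply: Rmult_le_compat_l; lra.
lra.
Qed.

(** For clique number 1 the right-hand side vanishes, while a nonempty edgeless graph has [h_number]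
    1; hence the assumption that the clique number is at least 2. *)
Theorem theorem1p2 (T : finType) (e : rel T)
  (e_sym : symmetric e) (e_irr : irreflexive e) (t : nat) :
  (1 <= t)%N ->
  ~ has_induced_matching e t ->
  (2 <= clique_number e)%N ->
  (INR (h_number e) <=
     10 * pow (INR t) t * pow (INR (clique_number e)) (3 * t - 3)%nat
        * ln (INR (clique_number e)))%R.
Proof.
case: t => // s _ noM w2.
have -> : (3 * s.+1 - 3 = 3 * s)%N by lia.
have T_gt0 : (0 < #|T|)%N.
  apply: contraLR w2; rewrite -leqNgt leqn0 -ltnNge => /eqP T0.
  rewrite ltnS; apply/bigmax_leqP => K _.
  by rewrite (leq_trans (max_card _)) // T0.
apply: leq_from_exponent_bounds => // m mh.
exact: unhit_max_stable_bound.
Qed.
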